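(* Let $\theta\in(0,1)$ and let every positive steady state of the system $\mathbf y'=\boldsymbol\Lambda_\theta\mathbf y$ (see context) be a fixed point of a map $\mathbf g\in\mathcal C^2(\mathbb R^2_{>0},\mathbb R^2_{>0})$. In addition, let the iterates generated by $\mathbf y^{n+1}=\mathbf g(\mathbf y^n)$ satisfy $\|\mathbf y^{n+1}\|_1=\|\mathbf y^n\|_1$ for all $n\in\mathbb N_0$. Let $\mathbf y^*$ be the unique positive steady state of the initial value problem, i.e. $\mathbf y^*=(1-\theta,\theta)^T$ for initial data with $\|\mathbf y^0\|_1=1$. Then the spectrum of the Jacobian $\mathbf D\mathbf g(\mathbf y^* )$ is $\{1,R\}$ with $R\in\mathbb R$. Furthermore, if $R<0$, then the method generated by $\mathbf g$ is overshooting the steady state.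
   Context: The initial value problem is $\mathbf y'(t)=\boldsymbol\Lambda_\theta\mathbf y(t)$, $\mathbf y(0)=\mathbf y^0>\mathbf 0$ with $$\boldsymbol\Lambda_\theta=\begin{pmatrix}-\theta&1-\theta\\ \theta&-(1-\theta)\end{pmatrix}.$$ The one-step method has iterates $\mathbf y^{n+1}=\mathbf g(\mathbf y^n)$. It is called not overshooting the steady state if, for every initial state $\mathbf y^0=(1-\epsilon,\epsilon)^T>\mathbf 0$: when $\epsilon<\theta$, the first iterate satisfies $y_2^1<\theta$ and $y_1^1>1-\theta$; and when $\epsilon>\theta$, it satisfies $y_2^1>\theta$ and $y_1^1<1-\theta$. Otherwise the method is said to be overshooting the steady state. *)

(* Defs.v *)
From HB Require Import structures.
From mathcomp Require Import all_boot all_order all_algebra.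
From mathcomp Require Import complex.
From mathcomp Require Import all_classical all_reals all_analysis.
From mathcomp Require Import lra.

Set Implicit Arguments.
Unset Strict Implicit.
Unset Printing Implicit Defensive.

Import Order.TTheory GRing.Theory Num.Theory.
Import numFieldNormedType.Exports.

Local Open Scope classical_set_scope.
Local Open Scope ring_scope.
Local Open Scope complex_scope.

(* Vectors are columns; the components y_1 and y_2 are y 0 0 and y 1 0. *)
Definition col2 (R : realType) (a b : R) : 'cV[R]_2 :=
  \col_(i < 2) (if i == 0 then a else b).

Definition positive (R : realType) : set 'cV[R]_2 :=
  [set y | forall i : 'I_2, 0 < y i 0].

Definition norm1 (R : realType) (n : nat) (y : 'cV[R]_n) : R :=
  \sum_(i < n) `|y i 0|.

Definition Lambda (R : realType) (theta : R) : 'M[R]_2 :=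
  \matrix_(i < 2, j < 2)
    (if i == 0 then (if j == 0 then - theta else 1 - theta)
     else (if j == 0 then theta else - (1 - theta))).

Definition steady_state (R : realType) (theta : R) (y : 'cV[R]_2) : Prop :=
  Lambda theta *m y = 0.

Definition ystar (R : realType) (theta : R) : 'cV[R]_2 :=
  col2 (1 - theta) theta.

(* The flow of y' = Lambda y preserves y_1 + y_2, so the steady state of an
   initial value problem with norm1 y0 = 1 is the one with norm1 y = 1. *)
Lemma ystar_unique (R : realType) (theta : R) : 0 < theta < 1 ->
  forall y : 'cV[R]_2,
    (positive y /\ steady_state theta y /\ norm1 y = 1) <-> y = ystar theta.
Proof.
move=> /andP[t0 t1] y.
have E2 (i : 'I_2) : i = 0 \/ i = 1.
  by case: i => -[|[|//]] p; [left|right]; apply/val_inj.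
split.
- move=> [yp [/matrixP ys yn]].
  have := ys 0 0; rewrite !mxE big_ord_recl big_ord1 !mxE /= => e1.
  move: yn; rewrite /norm1 big_ord_recl big_ord1 !gtr0_norm ?yp//.
  move: e1; rewrite (_ : lift ord0 ord0 = 1) => [e1 e2|]; last exact/val_inj.
  apply/matrixP => i j; rewrite (ord1 j) mxE.
  by case: (E2 i) => -> /=; move: e1 e2; rewrite (_ : ord0 = 0) //; nra.
- move=> ->; split; last split.
  + by move=> i; rewrite mxE; case: ifP => _; lra.
  + apply/matrixP => i j; rewrite !mxE big_ord_recl big_ord1 !mxE /=.
    by case: ifP => _; lra.
  + by rewrite /norm1 big_ord_recl big_ord1 !mxE /= !gtr0_norm; lra.
Qed.

(* Functions of class C^k on an open set D, by iterated partial derivatives;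
   the values of f outside D are irrelevant. *)
Fixpoint class_C (R : realType) (n : nat) (W : normedModType R) (k : nat)
    (D : set 'cV[R]_n) (f : 'cV[R]_n -> W) : Prop :=
  (forall x, D x -> {for x, continuous f}) /\
  match k with
  | 0 => True
  | k'.+1 => forall i : 'I_n,
      (forall x, D x -> derivable f x (delta_mx i 0)) /\
      class_C k' D ('D_(delta_mx i 0) f)
  end.

(* The library's jacobian is for maps between row vectors and acts on the
   right. *)
Definition jacobian_col (R : realType) (m n : nat)
    (g : 'cV[R]_n -> 'cV[R]_m) (y : 'cV[R]_n) : 'M[R]_(m, n) :=
  \matrix_(i < m, j < n) 'D_(delta_mx j 0) (fun x => g x i 0) y.

Definition spectrum (R : realType) (n : nat) (A : 'M[R]_n) : set R[i] :=
  [set z | eigenvalue (map_mx (real_complex R) A) z].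

Definition not_overshooting (R : realType) (theta : R)
    (g : 'cV[R]_2 -> 'cV[R]_2) : Prop :=
  forall eps : R, positive (col2 (1 - eps) eps) ->
    let y1 := g (col2 (1 - eps) eps) in
    (eps < theta -> y1 1 0 < theta /\ y1 0 0 > 1 - theta) /\
    (eps > theta -> y1 1 0 > theta /\ y1 0 0 < 1 - theta).

Definition overshooting (R : realType) (theta : R)
    (g : 'cV[R]_2 -> 'cV[R]_2) : Prop :=
  ~ not_overshooting theta g.

(* Main.v *)
Require Import Defs.
From HB Require Import structures.
From mathcomp Require Import all_boot all_order all_algebra.
From mathcomp Require Import complex.
From mathcomp Require Import all_classical all_reals all_analysis.
From mathcomp Require Import ring lra.

Set Implicit Arguments.
Unset Strict Implicit.
Unset Printing Implicit Defensive.

Import Order.TTheory GRing.Theory Num.Theory.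
Import numFieldNormedType.Exports.

Local Open Scope classical_set_scope.
Local Open Scope ring_scope.
Local Open Scope complex_scope.

(** Conservation of the 1-norm makes the two components of [g y] add up to
    y_1 + y_2 near the steady state, so both columns of the Jacobian J
    sum to 1. A 2x2 matrix with this property has the left eigenvector (1, 1)
    for the eigenvalue 1, and its trace gives the other eigenvalue
    R = J_22 - J_12, which is real ([jacobian_colsum1], [spectrum_colsum1]).

    Now R = D_2 g_2 - D_1 g_2, taken at the steady state, is also the slope at theta of
    eps |-> g_2 (1 - eps, eps), the map that describes one step on the segment
    of states of norm 1, and theta is a fixed point of this map. If R < 0, then
    starting slightly above theta the step lands strictly below theta, which is
    an overshoot. Since smoothness is given by partial derivatives only, this
    comparison does not go through a total differential: the increment of g_2
    along (-1, 1) is split into two increments along the axes, each one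
    controlled by the mean value theorem and by the continuity of the partial
    derivatives ([decr_along_difference]). *)

(** The column sums make the characteristic polynomial factor as
    (z - 1) (z - (A_22 - A_12)) in coordinates numbered from 1. *)
Lemma eigenvalue_colsum1 (F : fieldType) (A : 'M[F]_2) (z : F) :
  (forall j, A 0 j + A 1 j = 1) ->
  eigenvalue A z = (z == 1) || (z == A 1 1 - A 1 0).
Proof.
move=> cA.
have detE : \det (z%:M - A) = (z - 1) * (z - (A 1 1 - A 1 0)).
  rewrite (expand_det_row _ 0) big_ord_recl big_ord1 /cofactor !det_mx11 !mxE /=.
  have -> : lift 0 0 = 1 :> 'I_2 by exact/val_inj.
  have -> : lift 1 0 = 0 :> 'I_2 by exact/val_inj.
  have -> : ord0 = 0 :> 'I_2 by exact/val_inj.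
  have A0 j : A 0 j = 1 - A 1 j by rewrite -(cA j) addrK.
  by rewrite !A0 /= expr0 expr1; ring.
rewrite -[z == 1]subr_eq0 -[z == _ - _]subr_eq0 -mulf_eq0 -detE.
apply/eigenvalueP/det0P => [[v vA v0]|[v v0 vA]]; exists v => //.
  by rewrite mulmxBr vA mul_mx_scalar subrr.
by apply/eqP; rewrite -mul_mx_scalar eq_sym -subr_eq0 -mulmxBr vA.
Qed.

Lemma spectrum_colsum1 (R : realType) (A : 'M[R]_2) :
  (forall j, A 0 j + A 1 j = 1) ->
  spectrum A = [set 1; (A 1 1 - A 1 0)%:C].
Proof.
move=> cA; apply/seteqP.
have cAC j : map_mx (real_complex R) A 0 j + map_mx (real_complex R) A 1 j = 1.
  by rewrite !mxE -rmorphD cA rmorph1.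
split=> z; rewrite /spectrum /= (eigenvalue_colsum1 _ cAC) !mxE -rmorphB.
  by move=> /orP[] /eqP; [left|right].
by case=> ->; rewrite eqxx ?orbT.
Qed.

(** Reduces directional derivatives to derivatives of functions of one
    variable: the difference quotients on both sides are the same function. *)
Lemma is_derive_line (R : numFieldType) (V W : normedModType R) (f : V -> W)
    (a v : V) (t : R) (d : W) :
  is_derive (a + t *: v) v f d ->
  is_derive t 1 (fun s => f (a + s *: v)) d.
Proof.
case=> df <-.
have E : (fun h : R => h^-1 *: (((fun s => f (a + s *: v)) \o shift t) (h *: 1)
      - f (a + t *: v))) =
    (fun h => h^-1 *: ((f \o shift (a + t *: v)) (h *: v) - f (a + t *: v))).
  apply/funext => h /=; congr (_ *: (f _ - _)).
  by rewrite [h%:A]mulr1 scalerDl addrCA.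
by apply: DeriveDef; rewrite /derivable /derive E.
Qed.

Lemma MVT_line (R : realType) (V : normedModType R) (f df : V -> R)
    (a v : V) (t : R) : 0 < t ->
  (forall s, 0 <= s <= t -> is_derive (a + s *: v) v f (df (a + s *: v))) ->
  exists2 s, 0 <= s <= t & f (a + t *: v) - f a = df (a + s *: v) * t.
Proof.
move=> t0 fdf.
have dline s : s \in `[0, t] ->
    is_derive s 1 (fun s => f (a + s *: v)) (df (a + s *: v)).
  by rewrite in_itv /= => st; apply: is_derive_line; exact: fdf.
have cline : {within `[0, t], continuous (fun s => f (a + s *: v))}.
  by apply: derivable_within_continuous => s /dline ds; exact: ex_derive.
have doo s : s \in `]0, t[ ->
    is_derive s 1 (fun s => f (a + s *: v)) (df (a + s *: v)).
  by move=> st; apply: dline; exact: subset_itv_oo_cc st.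
have [s] := MVT t0 doo cline.
rewrite in_itv /= scale0r addr0 subr0 => /andP[/ltW s0 /ltW st] E.
by exists s; rewrite ?s0.
Qed.

(** The sign of D_(w - u) f, read off from D_w f - D_u f without a total
    differential. With b := a - t u, both a = b + t u
    and a + t (w - u) = b + t w are reached from b by a move along a single
    direction, so the mean value theorem compares f at the two points with
    f b; continuity keeps the slopes along u above, and those along w below, a
    common threshold. *)
Lemma decr_along_difference (R : realType) (V : normedModType R)
    (f du dw : V -> R) (a u w : V) :
  (\forall x \near a, is_derive x u f (du x)) ->
  (\forall x \near a, is_derive x w f (dw x)) ->
  {for a, continuous du} -> {for a, continuous dw} ->
  dw a < du a ->
  \forall t \near (0 : R)^'+, f (a + t *: (w - u)) < f a.
Proof.
move=> fu fw cu cw wu.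
pose m := (dw a + du a) / 2.
have wm : dw a < m by rewrite /m; lra.
have mu : m < du a by rewrite /m; lra.
have nearU : \forall x \near a, m < du x by exact: (cvgr_gt _ cu).
have nearW : \forall x \near a, dw x < m by exact: (cvgr_lt _ cw).
have /nbhs_normP[e /= e0 ae] : \forall x \near a,
    (is_derive x u f (du x) /\ m < du x) /\ (is_derive x w f (dw x) /\ dw x < m).
  by near=> x; split; split; near: x.
(* The summand 1 keeps the divisor positive when u = w = 0. *)
have k0 : 0 < `|u| + `|w| + 1 by rewrite ltr_wpDl// addr_ge0.
near=> t.
have t0 : 0 < t by near: t; exact: nbhs_right_gt.
have tk : t * (`|u| + `|w| + 1) < e.
  rewrite -ltr_pdivlMr//; near: t; apply: nbhs_right_lt.
  exact: divr_gt0.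
pose b := a - t *: u.
(* All points visited below differ from a by some p with this bound. *)
have small x p : `|p| <= t * (`|u| + `|w|) -> x = a + p ->
    (is_derive x u f (du x) /\ m < du x) /\ (is_derive x w f (dw x) /\ dw x < m).
  move=> pt ->; apply: ae; rewrite /ball_ /= opprD addrA subrr sub0r normrN.
  by apply: le_lt_trans pt _; apply: le_lt_trans tk; rewrite ler_pM2l// lerDl.
have nearbu s : 0 <= s <= t ->
    is_derive (b + s *: u) u f (du (b + s *: u)) /\ m < du (b + s *: u).
  move=> /andP[s0 st]; apply: (proj1 (small _ ((s - t) *: u) _ _)).
    rewrite normrZ ler_pM// ?lerDl// ler0_norm; lra.
  by rewrite scalerBl /b -addrA [- _ + _]addrC.
have nearbw s : 0 <= s <= t ->
    is_derive (b + s *: w) w f (dw (b + s *: w)) /\ dw (b + s *: w) < m.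
  move=> /andP[s0 st]; apply: (proj2 (small _ (s *: w - t *: u) _ _)).
    rewrite (le_trans (ler_normB _ _))// !normrZ (ger0_norm s0) (ger0_norm (ltW t0)).
    by rewrite mulrDr [leRHS]addrC lerD2r ler_wpM2r.
  by rewrite /b -addrA [- _ + _]addrC.
have [s1 /nearbu[_ ms1]] := MVT_line t0 (fun s st => (nearbu s st).1).
rewrite [b + t *: u]subrK => E1.
have [s2 /nearbw[_ ms2]] := MVT_line t0 (fun s st => (nearbw s st).1).
have -> : a + t *: (w - u) = b + t *: w.
  by rewrite scalerBr /b addrAC addrA.
move=> E2; rewrite -(ltrD2r (- f b)) E1 E2 ltr_pM2r//.
exact: lt_trans ms1.
Unshelve. all: by end_near. Qed.

Lemma is_derive_coord (R : realFieldType) (V : normedModType R) (m n : nat)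
    (f : V -> 'M[R]_(m, n)) (x v : V) (i : 'I_m) (j : 'I_n) :
  derivable f x v -> is_derive x v (fun y => f y i j) ('D_v f x i j).
Proof.
move=> df; apply: DeriveDef; first exact: (derivable_mxP f x v).1.
by rewrite derive_mx// mxE.
Qed.

Lemma near_positive (R : realType) (y : 'cV[R]_2) :
  positive y -> \forall x \near y, positive x.
Proof.
move=> yp.
suff : nbhs y [set x : 'cV[R]_2 | forall i, 0 < x i 0] by [].
apply: (@filter_forall _ _ (fun i => [set x : 'cV[R]_2 | 0 < x i 0]) (nbhs y)) => i.
have ci : {for y, continuous (fun x : 'cV[R]_2 => x i 0)}.
  exact: coord_continuous.
exact: (cvgr_gt _ ci).
Qed.

Lemma norm1_positive (R : realType) (y : 'cV[R]_2) :
  positive y -> norm1 y = y 0 0 + y 1 0.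
Proof.
move=> yp; rewrite /norm1 big_ord_recl big_ord1 !gtr0_norm ?yp//.
by congr (_ + y _ 0); exact/val_inj.
Qed.

(** The columns of J add up to the partial derivatives of x_1 + x_2, which
    g conserves near y. *)
Lemma jacobian_colsum1 (R : realType) (g : 'cV[R]_2 -> 'cV[R]_2)
    (y : 'cV[R]_2) (j : 'I_2) :
  (\forall x \near y, g x 0 0 + g x 1 0 = x 0 0 + x 1 0) ->
  derivable g y (delta_mx j 0) ->
  jacobian_col g y 0 j + jacobian_col g y 1 j = 1.
Proof.
move=> gsum dg; rewrite !mxE.
have dc i := is_derive_coord i 0 dg.
have did i := is_derive_coord i 0 (@derivable_id _ 'cV[R]_2 y (delta_mx j 0)).
have := @near_eq_derive _ _ _ _ _ _ (delta_mx j 0) gsum.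
rewrite !deriveD; try exact: ex_derive.
rewrite (@derive_val _ _ _ _ _ _ _ (did 0)) (@derive_val _ _ _ _ _ _ _ (did 1)).
move=> ->; rewrite derive_id !mxE.
by case: j {dg dc did} => -[|[|//]] p; rewrite /= ?addr0 ?add0r.
Qed.

Theorem theorem5p9 (R : realType) (theta : R) (g : 'cV[R]_2 -> 'cV[R]_2)
  (htheta : 0 < theta < 1)
  (gpos : forall y : 'cV[R]_2, positive y -> positive (g y))
  (gC2 : class_C 2 (@positive R) g)
  (gfix : forall y : 'cV[R]_2,
    positive y -> steady_state theta y -> g y = y)
  (gnorm : forall y0 : 'cV[R]_2, positive y0 ->
    forall n : nat, norm1 (iter n.+1 g y0) = norm1 (iter n g y0)) :
  exists r : R,
    spectrum (jacobian_col g (ystar theta)) = [set 1; r%:C] /\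
    (r < 0 -> overshooting theta g).
Proof.
have /andP[th0 th1] := htheta.
have [ysp [yss _]] := (ystar_unique htheta (ystar theta)).2 erefl.
set a := ystar theta in ysp yss *.
have [_ gC1] := gC2.
have dg j x : positive x -> derivable g x (delta_mx j 0).
  by move=> xp; exact: (gC1 j).1.
have gsum : \forall x \near a, g x 0 0 + g x 1 0 = x 0 0 + x 1 0.
  near=> x; have xp : positive x by near: x; exact: near_positive.
  by rewrite -!norm1_positive//; [exact: (gnorm x xp 0%N)|exact: gpos].
pose J := jacobian_col g a.
have Jsum j : J 0 j + J 1 j = 1 by apply: jacobian_colsum1 => //; exact: dg.
exists (J 1 1 - J 1 0); split; first exact: spectrum_colsum1.
move=> r0 nover.
pose dir j x := 'D_(delta_mx j 0) g x 1 0.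
have dir_cont j : {for a, continuous (dir j)}.
  apply: (@continuous_comp _ _ _ ('D_(delta_mx j 0) g)
    (fun M : 'cV[R]_2 => M 1 0)); last exact: coord_continuous.
  exact: ((gC1 j).2.1 a ysp).
have dir_derive j : \forall x \near a,
    is_derive x (delta_mx j 0) (fun y => g y 1 0) (dir j x).
  near=> x; apply: is_derive_coord; apply: dg.
  by near: x; exact: near_positive.
have dirJ j : dir j a = J 1 j.
  by rewrite mxE (@derive_val _ _ _ _ _ _ _ (nbhs_singleton (dir_derive j))).
have decr := decr_along_difference (dir_derive 0) (dir_derive 1)
  (dir_cont 0) (dir_cont 1).
have {decr}/decr gt : dir 1 a < dir 0 a by rewrite !dirJ -subr_lt0.
(* Moving from the steady state along e_2 - e_1 stays among the admissible
   initial states. *)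
have lineE t : a + t *: (delta_mx 1 0 - delta_mx 0 0) =
    col2 (1 - (theta + t)) (theta + t).
  apply/matrixP => i j; rewrite (ord1 j) !mxE.
  by case: i => -[|[|//]] p; rewrite /=; lra.
have [t [t0 posx below]] : exists t : R, [/\ 0 < t, positive (col2 (1 - (theta + t)) (theta + t))
    & g (col2 (1 - (theta + t)) (theta + t)) 1 0 < theta].
  near (0 : R)^'+ => t; exists t; split.
  - by near: t; exact: nbhs_right_gt.
  - move=> i; rewrite mxE; case: ifP => _.
      rewrite subr_gt0 -ltrBrDl; near: t; apply: nbhs_right_lt.
      by rewrite subr_gt0.
    by rewrite addr_gt0//; near: t; exact: nbhs_right_gt.
  - rewrite -lineE.
    have -> : theta = g a 1 0 by rewrite gfix// mxE.
    by near: t.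
have [_ over] := nover _ posx.
have [] := over; first by rewrite ltrDl.
by move=> above; have := lt_trans above below; rewrite ltxx.
Unshelve. all: by end_near. Qed.
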